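(* Let $G_1$ and $G_2$ be two groups each of which contains an infinite order element. Let $H$ be a finite height subgroup of $G=G_1\times G_2$ such that $H$ contains an infinite order element. Then $H$ has finite index in $G$. In particular, if $H$ is an almost malnormal subgroup of $G$ and $H$ contains an infinite order element, then $H=G$.
   Context: Height: the height of a subgroup $H$ of a group $G$ is the smallest number $n$ with the property that for any $n+1$ distinct left cosets $g_1H,\dots,g_{n+1}H$ the intersection $\bigcap_i g_iHg_i^{-1}$ is finite. $H$ has finite height in $G$ if such an $n$ exists. Almost malnormal: a subgroup $H\le G$ is almost malnormal if $gHg^{-1}\cap H$ is finite for each $g\in G\setminus H$. *)

(* Defs.v *)
From mathcomp Require Import all_boot.
From mathcomp Require Import boolp classical_sets functions cardinality.

Set Implicit Arguments.
Unset Strict Implicit.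
Unset Printing Implicit Defensive.

Local Open Scope group_scope.
Local Open Scope classical_set_scope.

Section Subgroups.
Context {G : groupType}.
Implicit Types (H : set G) (g x : G) (n : nat).

(* [group_closed] is about boolean predicates; [x \in H] is the classical
   boolean reflecting [H x]. *)
Definition is_subgroup H : Prop := group_closed [pred x | x \in H].

Definition infinite_order x : Prop := forall n, (0 < n)%N -> x ^+ n <> 1.

Definition left_coset g H : set G := [set g * h | h in H].

(* g H g^-1, whereas the library's [h ^ g] is g^-1 h g. *)
Definition conj_set g H : set G := [set g * h * g^-1 | h in H].

Definition finite_index H : Prop := finite_set [set left_coset g H | g in setT].

Definition finite_conj_intersections H n : Prop :=
  forall g : 'I_n.+1 -> G,
    injective (fun i => left_coset (g i) H) ->
    finite_set (\bigcap_(i in [set: 'I_n.+1]) conj_set (g i) H).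

Definition is_height H n : Prop :=
  finite_conj_intersections H n /\
  forall m, finite_conj_intersections H m -> (n <= m)%N.

Definition finite_height H : Prop := exists n, is_height H n.

Definition almost_malnormal H : Prop :=
  forall g, ~ H g -> finite_set (conj_set g H `&` H).

End Subgroups.

(* Main.v *)
(* If [u] in [H] has infinite order and [z] commutes with [u], then
   [u \in z H z^-1].  Hence, when [H] has finite height, the centralizer of [u]
   meets only finitely many left cosets of [H], and every [z] in it has a
   positive power in [H].  Starting from [h = (a, b)] in [H] with, say, [a] of
   infinite order, [(a, 1)] commutes with [h], so some [(a ^+ k, 1)] is in [H];
   its centralizer contains [1 x G2], so [H] contains some [(1, y ^+ j)] of
   infinite order, whose centralizer contains [G1 x 1].  Thus both factors meet
   finitely many cosets of [H], and so does [G1 x G2].  If [H] is almost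
   malnormal, its height is at most 1 and it contains the whole centralizer of
   each of its elements of infinite order, hence both factors. *)
Require Import Defs.
From mathcomp Require Import all_boot.
From mathcomp Require Import boolp classical_sets functions cardinality.

Local Open Scope group_scope.
Local Open Scope classical_set_scope.

Section SubgroupSets.
Context {G : groupType}.
Implicit Types (H C : set G) (g u x z : G).

Lemma subgroup1 {H} : is_subgroup H -> H 1.
Proof. by case=> + _ => /set_mem. Qed.

Lemma subgroupV {H} x : is_subgroup H -> H x -> H x^-1.
Proof. by move=> /group_closedV HV /mem_set /HV /set_mem. Qed.

Lemma subgroupM {H} x z : is_subgroup H -> H x -> H z -> H (x * z).
Proof.
by move=> /group_closedM HM /mem_set Hx /mem_set Hz; apply/set_mem/HM.
Qed.

Lemma left_coset_eq {H} x z : is_subgroup H ->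
  left_coset x H = left_coset z H <-> H (x^-1 * z).
Proof.
move=> sH; split=> [E | Hxz].
  have : left_coset z H z by exists 1; [exact: subgroup1 | rewrite mulg1].
  by rewrite -E => -[h Hh <-]; rewrite mulKg.
apply/seteqP; split=> _ [h Hh <-].
  exists ((x^-1 * z)^-1 * h); first by apply: subgroupM => //; apply: subgroupV.
  by rewrite invgM invgK !mulgA mulgV mul1g.
exists (x^-1 * z * h); first exact: subgroupM.
by rewrite !mulgA mulgV mul1g.
Qed.

(** Asking for distinct values only when [m < n] lets callers work with the natural number [n - m],
    as an exponent of a group element. *)
Lemma infinite_sequence {T : Type} {A : set T} {f : nat -> T} :
  (forall m n, (m < n)%N -> f m <> f n) -> (forall n, A (f n)) ->
  infinite_set A.
Proof.
move=> f_neq Af fA; apply: infinite_nat.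
have -> : [set: nat] = f @^-1` A by apply/seteqP; split=> n _; [exact: Af|].
apply: finite_preimage fA => m n _ _ E.
by case: (ltngtP m n) => // /f_neq; rewrite E; case.
Qed.

Lemma infinite_orderX u k : (0 < k)%N ->
  infinite_order u -> infinite_order (u ^+ k).
Proof.
by move=> k0 uoo n n0; rewrite -expgnA; apply: uoo; rewrite muln_gt0 k0.
Qed.

Lemma subgroupX {H} x n : is_subgroup H -> H x -> H (x ^+ n).
Proof.
move=> sH Hx; elim: n => [|n IHn]; first exact: subgroup1.
by rewrite expgS; apply: subgroupM.
Qed.

Lemma infinite_powers {u} (A : set G) : infinite_order u ->
  (forall n, A (u ^+ n)) -> infinite_set A.
Proof.
move=> uoo; apply: infinite_sequence => m n lt_mn E.
apply: (uoo (n - m)%N); first by rewrite subn_gt0.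
by rewrite expgnFr ?(ltnW lt_mn) // E mulgV.
Qed.

Lemma conj_set_commute {H} u z : H u -> commute u z -> conj_set z H u.
Proof. by move=> Hu cuz; exists u => //; rewrite -cuz mulgK. Qed.

(** Otherwise some sequence of pairwise distinct cosets has representatives in [C]. The conjugates
    of [H] by the first [n.+1] of them all contain every power of [u], so their intersection is
    infinite. *)
Lemma centralizer_cosets {H n u} (C : set G) : is_subgroup H ->
  finite_conj_intersections H n -> H u -> infinite_order u ->
  (forall z, C z -> commute u z) ->
  finite_set [set left_coset z H | z in C].
Proof.
move=> sH fH Hu uoo cC; apply/not_notP => /infiniteP /pcard_leP [f].
have /choice [g gP] : forall m, exists z, C z /\ left_coset z H = f m.
  by move=> m; have [z Cz E] := 'funS_f (I : setT m); exists z.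
apply: (infinite_powers _ uoo) (fH (fun i => g i) _) => [m i _|i j /= E].
  apply: conj_set_commute; first exact: subgroupX.
  by apply/commute_sym/commuteX/commute_sym/cC; have [] := gP i.
apply/val_inj/(inj (f := f)); rewrite ?inE //=.
by have [_ <-] := gP i; have [_ <-] := gP j.
Qed.

(** Pigeonhole: the powers of [z] commute with [u], so they meet finitely many cosets. Two of them,
    [z ^+ m] and [z ^+ p] with [m < p], share a coset, which puts [z ^+ (p - m)] in [H]. *)
Lemma centralizer_power_mem {H n u} z : is_subgroup H ->
  finite_conj_intersections H n -> H u -> infinite_order u -> commute u z ->
  exists2 k, (0 < k)%N & H (z ^+ k).
Proof.
move=> sH fH Hu uoo cuz; apply/not_notP => noz.
have : finite_set [set left_coset x H | x in range (fun m => z ^+ m)].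
  by apply: centralizer_cosets sH fH Hu uoo _ => _ [m _ <-]; apply: commuteX.
apply: (infinite_sequence (f := fun m => left_coset (z ^+ m) H)) => m.
  move=> p lt_mp /(left_coset_eq _ _ sH); rewrite -(subnKC (ltnW lt_mp)).
  rewrite expgnDr mulKg => Hz; apply: noz.
  by exists (p - m)%N; rewrite ?subn_gt0.
by exists (z ^+ m) => //; exists m.
Qed.

Lemma almost_malnormal_conj_intersections {H} : is_subgroup H ->
  almost_malnormal H -> finite_conj_intersections H 1.
Proof.
move=> sH mH g g_inj.
(* Conjugation by [g ord0] carries the intersection of [H] and its conjugate by [k] onto that of the
   two given conjugates. *)
pose k := (g ord0)^-1 * g ord_max.
have Hk : ~ H k by move=> /(left_coset_eq _ _ sH)/g_inj.
pose conj x := g ord0 * x * (g ord0)^-1.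
apply: sub_finite_set (finite_image conj (mH k Hk)) => x xg.
have [h0 Hh0 E0] := xg ord0 I; have [h1 Hh1 E1] := xg ord_max I.
exists h0 => //; split=> //; exists h1 => //.
apply: (mulgI (g ord0)); apply: (mulIg (g ord0)^-1); rewrite E0 -E1.
by rewrite /k invgM invgK !mulgA mulgV mul1g mulgK.
Qed.

Lemma almost_malnormal_centralizer {H u} z : is_subgroup H ->
  almost_malnormal H -> H u -> infinite_order u -> commute u z -> H z.
Proof.
move=> sH mH Hu uoo cuz; apply/not_notP => /mH.
apply: (infinite_powers _ uoo) => m; have Hum := subgroupX _ m sH Hu.
by split=> //; apply: conj_set_commute => //; apply/commute_sym/commuteX.
Qed.

End SubgroupSets.

Section Product.
Context {G1 G2 : groupType}.
Implicit Types (H : set (G1 * G2)) (a : G1) (b : G2).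

Lemma mulg_pair a b a' b' : (a, b) * (a', b') = (a * a', b * b').
Proof. by []. Qed.

Lemma expg_pair a b n : (a, b) ^+ n = (a ^+ n, b ^+ n).
Proof. by elim: n => // n IHn; rewrite !expgS IHn. Qed.

Lemma infinite_order_fst a b :
  infinite_order a -> infinite_order ((a, b) : G1 * G2).
Proof. by move=> aoo n n0; rewrite expg_pair => -[/(aoo n n0)]. Qed.

Lemma infinite_order_snd a b :
  infinite_order b -> infinite_order ((a, b) : G1 * G2).
Proof. by move=> boo n n0; rewrite expg_pair => -[_ /(boo n n0)]. Qed.

Lemma infinite_order_pair a b : infinite_order ((a, b) : G1 * G2) ->
  infinite_order a \/ infinite_order b.
Proof.
move=> oo; apply/not_notP => /not_orP[].
move=> /existsNP[m /not_implyP[m0 /contrapT am]].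
move=> /existsNP[n /not_implyP[n0 /contrapT bn]].
(* With [a ^+ m = 1] and [b ^+ n = 1], the exponent [m * n] kills both coordinates. *)
apply: (oo (m * n)%N); first by rewrite muln_gt0 m0.
by rewrite expg_pair expgnA am expg1n mulnC expgnA bn expg1n.
Qed.

Lemma commute_axes a b : commute ((a, 1) : G1 * G2) (1, b).
Proof. by rewrite /commute !mulg_pair !mul1g !mulg1. Qed.

Lemma axes_infinite_order {H n} :
  (exists x : G1, infinite_order x) -> (exists y : G2, infinite_order y) ->
  is_subgroup H -> finite_conj_intersections H n ->
  (exists2 h, H h & infinite_order h) ->
  (exists2 a, infinite_order a & H (a, 1)) /\
  (exists2 b, infinite_order b & H (1, b)).
Proof.
move=> [x xoo] [y yoo] sH fH [[a b] Hab ab_oo].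
(* Crossing from one axis to the other works in both directions, so either coordinate of [h] may be
   the one of infinite order. *)
have fst_snd a' : infinite_order a' -> H (a', 1) ->
    exists2 b', infinite_order b' & H (1, b').
  move=> aoo Ha; have [||k k0] := centralizer_power_mem (1, y) sH fH Ha.
  - exact: infinite_order_fst.
  - exact: commute_axes.
  by rewrite expg_pair expg1n; exists (y ^+ k) => //; apply: infinite_orderX.
have snd_fst b' : infinite_order b' -> H (1, b') ->
    exists2 a', infinite_order a' & H (a', 1).
  move=> boo Hb; have [||k k0] := centralizer_power_mem (x, 1) sH fH Hb.
  - exact: infinite_order_snd.
  - exact/commute_sym/commute_axes.
  by rewrite expg_pair expg1n; exists (x ^+ k) => //; apply: infinite_orderX.
case: (infinite_order_pair _ _ ab_oo) => [aoo|boo].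
  have [|k k0] := centralizer_power_mem (a, 1) sH fH Hab ab_oo.
    by rewrite /commute !mulg_pair mul1g mulg1.
  rewrite expg_pair expg1n => Ha.
  have aoo' := infinite_orderX _ _ k0 aoo.
  by split; [exists (a ^+ k) | apply: fst_snd Ha].
have [|k k0] := centralizer_power_mem (1, b) sH fH Hab ab_oo.
  by rewrite /commute !mulg_pair mul1g mulg1.
rewrite expg_pair expg1n => Hb.
have boo' := infinite_orderX _ _ k0 boo.
by split; [apply: snd_fst Hb | exists (b ^+ k)].
Qed.

Lemma finite_index_axes {H} : is_subgroup H ->
  finite_set [set left_coset (a, 1) H | a in [set: G1]] ->
  finite_set [set left_coset (1, b) H | b in [set: G2]] ->
  finite_index H.
Proof.
move=> sH f1 f2.
(* [(a, 1) H] and [(1, b) H] determine [(a, b) H]: multiply the elements of the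
   former in [G1 x 1] by those of the latter in [1 x G2], then by [H]. *)
pose F (X Y : set (G1 * G2)) : set (G1 * G2) :=
  [set z | exists a b h, [/\ X (a, 1), Y (1, b), H h & z = (a, b) * h]].
apply: sub_finite_set (finite_image2 F f1 f2) => _ [[a b] _ <-].
exists (left_coset (a, 1) H); first by exists a.
exists (left_coset (1, b) H); first by exists b.
apply/seteqP; split=> [_ [a' [b' [h [Xa Yb Hh ->]]]] | _ [h Hh <-]].
  have [h1 Hh1 E1] := Xa; have [h2 Hh2 E2] := Yb.
  (* Comparing coordinates, [h1 = (c1, 1)] and [h2 = (1, d2)] with [a' = a * c1] and [b' = b * d2],
     hence [(a, b) * h1 * h2 = (a', b')]. *)
  exists (h1 * h2 * h); first by do !apply: subgroupM.
  rewrite !mulgA; congr (_ * _).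
  case: h1 h2 Hh1 Hh2 E1 E2 => [c1 d1] [c2 d2] _ _.
  rewrite !mulg_pair !mul1g => -[<- ->] [-> <-].
  by rewrite !mulg1.
exists a, b, h; split=> //; exists 1; rewrite ?mulg1 //; exact: subgroup1.
Qed.

End Product.

Theorem lemma2 (G1 G2 : groupType)
    (hG1 : exists x : G1, infinite_order x)
    (hG2 : exists y : G2, infinite_order y) :
  (forall H : set (G1 * G2),
     is_subgroup H ->
     finite_height H ->
     (exists2 h, H h & infinite_order h) ->
     finite_index H) /\
  (forall H : set (G1 * G2),
     is_subgroup H ->
     almost_malnormal H ->
     (exists2 h, H h & infinite_order h) ->
     H = setT).
Proof.
split=> H sH.
  move=> [n [fH _]] Hoo.
  have [[a aoo Ha] [b boo Hb]] := axes_infinite_order hG1 hG2 sH fH Hoo.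
  apply: finite_index_axes => //.
    (* This exhibits the cosets as those of the points of the axis [G1 x 1], which centralizes
       [(1, b)]. *)
    rewrite -(image_comp (fun x : G1 => (x, 1)) (fun z => left_coset z H)).
    apply: (centralizer_cosets _ sH fH Hb); first exact: infinite_order_snd.
    by move=> _ [x _ <-]; apply/commute_sym/commute_axes.
  rewrite -(image_comp (fun y : G2 => (1, y)) (fun z => left_coset z H)).
  apply: (centralizer_cosets _ sH fH Ha); first exact: infinite_order_fst.
  by move=> _ [y _ <-]; apply: commute_axes.
move=> mH Hoo.
have fH := almost_malnormal_conj_intersections sH mH.
have [[a aoo Ha] [b boo Hb]] := axes_infinite_order hG1 hG2 sH fH Hoo.
apply/seteqP; split=> // -[x y] _.
have -> : (x, y) = (x, 1) * (1, y) by rewrite mulg_pair mul1g mulg1.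
apply: subgroupM => //.
  apply: (almost_malnormal_centralizer _ sH mH Hb).
    exact: infinite_order_snd.
  exact/commute_sym/commute_axes.
apply: (almost_malnormal_centralizer _ sH mH Ha).
  exact: infinite_order_fst.
exact: commute_axes.
Qed.
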